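(* Let $n \ge 0$ and let $(F_k)_{k \in \mathbb{Z}}$ be a complex sequence supported in $\{0, \ldots, n\}$ (i.e. $F_k = 0$ for $k \notin \{0,\ldots,n\}$) whose Non-Linear Fourier Transform is $(a(z), b(z))$. For every $k \in \mathbb{Z}$ define $$\psi_k = \begin{cases} -\frac{1}{2} \arctan\left(\frac{\mathrm{Re}(F_k)}{\mathrm{Im}(F_k)}\right) & F_k \notin \mathbb{R}, \\ -\frac{\pi}{4} & F_k \in \mathbb{R} \setminus \{0\}, \\ 0 & F_k = 0, \end{cases}$$ and, for $0 \le k \le n$, define the generalized phase factors $$\lambda = \psi_0, \qquad \theta_k = \psi_{k+1} - \psi_k, \qquad \phi_k = \arctan\left(-i e^{-2i\psi_k} F_k\right).$$ Then the GQSP protocol $$e^{i\lambda Z} e^{i\phi_0 X} e^{i\theta_0 Z} \, \tilde{w} \, e^{i\phi_1 X} e^{i\theta_1 Z} \, \tilde{w} \cdots \tilde{w} \, e^{i\phi_n X} e^{i\theta_n Z}, \qquad \tilde{w} = \mathrm{diag}(z,1),\ z \in \mathbb{T},$$ achieves $(P,Q) := (z^n a, b)$, i.e. the first row of this product is $(z^n a(z), b(z))$ for all $z \in \mathbb{T}$.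
   Context: $\mathbb{T} = \{z \in \mathbb{C} : |z| = 1\}$. $X = \begin{bmatrix} 0 & 1 \\ 1 & 0\end{bmatrix}$ and $Z = \begin{bmatrix} 1 & 0 \\ 0 & -1\end{bmatrix}$ are Pauli matrices. For a complex number $c$, $c^*$ is its complex conjugate; for a function $f$ of a complex variable, $f^*(z) := \overline{f(1/\overline{z})}$. Non-Linear Fourier Transform (NLFT) over $SU(2)$: for a complex sequence $F=(F_k)_{k\in\mathbb{Z}}$, $$\mathcal{G}_F(z) = \prod_{k=-\infty}^{+\infty} \frac{1}{\sqrt{1+|F_k|^2}} \begin{bmatrix} 1 & F_k z^k \\ -F_k^* z^{-k} & 1 \end{bmatrix}, \qquad z \in \mathbb{T},$$ where the factors are ordered from left to right by increasing $k$ (for finitely supported $F$ this is a finite product, since the other factors are the identity). The pair $(a,b)$ is shorthand for the unique $SU(2)$ element whose first row is $(a,b)$, i.e. $\begin{bmatrix} a & b \\ -b^* & a^*\end{bmatrix}$; ''the NLFT of $F$ is $(a(z),b(z))$'' means $\mathcal{G}_F(z) = (a(z),b(z))$. With the choice $\psi_k = -\frac{1}{2}\arctan\left(\frac{\mathrm{Re}(F_k)}{\mathrm{Im}(F_k)}\right)$ if $F_k \notin \mathbb{R}$, $\psi_k = -\frac{\pi}{4}$ if $F_k \in \mathbb{R}\setminus\{0\}$, and $\psi_k = 0$ if $F_k = 0$, the number $-i e^{-2i\psi_k}F_k$ is real, and $\arctan$ is the real arctangent with values in $(-\frac{\pi}{2},\frac{\pi}{2})$. *)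

(* Defs.v *)
From HB Require Import structures.
From mathcomp Require Import all_boot all_order all_algebra.
From mathcomp Require Import complex.
From mathcomp Require Import all_classical all_reals all_analysis.

Set Implicit Arguments.
Unset Strict Implicit.
Unset Printing Implicit Defensive.

Import Order.TTheory GRing.Theory Num.Theory.
Import numFieldNormedType.Exports.

Local Open Scope classical_set_scope.
Local Open Scope ring_scope.
Local Open Scope complex_scope.

(* The norm topology on R[i]; matrices over R[i] inherit the sup norm. *)
HB.instance Definition _ (R : realType) := NormedModule.copy R[i] R[i]^o.

Definition expC (R : realType) (z : R[i]) : R[i] :=
  lim (series (fun k : nat => z ^+ k / k`!%:R) @ \oo).

Definition expmx (R : realType) (n : nat) (A : 'M[R[i]]_n.+1) :
    'M[R[i]]_n.+1 :=
  lim (series (fun k : nat => (k`!%:R)^-1 *: A ^+ k) @ \oo).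

Definition mx22 (R : realType) (a b c d : R[i]) : 'M[R[i]]_2 :=
  \matrix_(i < 2, j < 2)
    if i == 0 then (if j == 0 then a else b) else (if j == 0 then c else d).

Definition pauliX (R : realType) : 'M[R[i]]_2 := mx22 0 1 1 0.
Definition pauliZ (R : realType) : 'M[R[i]]_2 := mx22 1 0 0 (-1).

Definition fstar (R : realType) (f : R[i] -> R[i]) : R[i] -> R[i] :=
  fun z => (f (1 / z^*))^*.

Definition su2_pair (R : realType) (a b : R[i] -> R[i]) (z : R[i]) :
    'M[R[i]]_2 :=
  mx22 (a z) (b z) (- fstar b z) (fstar a z).

Definition nlft_factor (R : realType) (F : int -> R[i]) (z : R[i]) (k : int) :
    'M[R[i]]_2 :=
  (1 / sqrtC (1 + `|F k| ^+ 2)) *: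
    mx22 1 (F k * z ^ k) (- (F k)^* * z ^ (- k)) 1.

(* The noncommutative product over all integers, in increasing order from left
   to right, is the limit of the products over the windows -p <= k < q as p and
   q tend to infinity independently. *)
Definition nlft (R : realType) (F : int -> R[i]) (z : R[i]) : 'M[R[i]]_2 :=
  lim ((fun pq : nat * nat =>
          \prod_(0 <= i < pq.1 + pq.2) nlft_factor F z (i%:Z - pq.1%:Z))
       @ (\oo, \oo)).

Definition is_nlft (R : realType) (F : int -> R[i]) (a b : R[i] -> R[i]) :
    Prop :=
  forall z : R[i], `|z| = 1 -> nlft F z = su2_pair a b z.

Definition nlft_psi (R : realType) (c : R[i]) : R :=
  if c == 0 then 0
  else if c \is Num.real then - (pi / 4)
  else - (1 / 2) * atan (complex.Re c / complex.Im c).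

(* The argument of the real arctangent is a complex number that is always real
   when psi = nlft_psi c; complex.Re only casts it to R. *)
Definition nlft_phi (R : realType) (psi : R) (c : R[i]) : R :=
  atan (complex.Re (- 'i * expC (- (2 * 'i * psi%:C)) * c)).

(* Leading factor e^{i lambda Z}, then e^{i phi_0 X} e^{i theta_0 Z}, then the
   blocks w~ e^{i phi_k X} e^{i theta_k Z} for k = 1, ..., n from left to
   right. *)
Definition gqsp (R : realType) (n : nat) (lambda : R) (theta phi : nat -> R)
    (z : R[i]) : 'M[R[i]]_2 :=
  let eX (t : R) := expmx (('i * t%:C) *: pauliX R) in
  let eZ (t : R) := expmx (('i * t%:C) *: pauliZ R) in
  let w := mx22 z 0 0 1 in
  eZ lambda * (eX (phi 0) * eZ (theta 0)) *
    \prod_(1 <= k < n.+1) (w * (eX (phi k) * eZ (theta k))).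

Definition gqsp_achieves (R : realType) (n : nat) (lambda : R)
    (theta phi : nat -> R) (P Q : R[i] -> R[i]) : Prop :=
  forall z : R[i], `|z| = 1 ->
    gqsp n lambda theta phi z 0 0 = P z /\ gqsp n lambda theta phi z 0 1 = Q z.

(* Main.v *)
(* A phase psi with -i e^{-2 i psi} F real makes the normalized NLFT factor at
   z = 1 equal to e^{i psi Z} e^{i phi X} e^{-i psi Z}, where
   phi = arctan (-i e^{-2 i psi} F). Diagonal matrices commute, so inserting
   theta_k = psi_{k+1} - psi_k telescopes the Z-rotations, and moving the
   signal operators w~ = diag(z, 1) to the right conjugates the k-th factor by
   w~^k, which turns F_k into F_k z^k. What is left over is w~^n = diag(z^n, 1)
   and e^{i psi_{n+1} Z} = 1. *)
Require Import Defs.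
From mathcomp Require Import all_boot all_order all_algebra.
From mathcomp Require Import complex.
From mathcomp Require Import all_classical all_reals all_analysis.
From mathcomp Require Import ring lra.

Set Implicit Arguments.
Unset Strict Implicit.
Unset Printing Implicit Defensive.

Import Order.TTheory GRing.Theory Num.Theory.
Import numFieldNormedType.Exports.

Local Open Scope classical_set_scope.
Local Open Scope ring_scope.
Local Open Scope complex_scope.

(** * Exponential series of imaginary numbers and of involutions *)

Lemma cvg_real_complex (R : realType) (u : nat -> R) (l : R) :
  u @ \oo --> l -> (fun k => (u k)%:C : R[i]) @ \oo --> (l%:C : R[i]).
Proof.
(* The tolerance in [R[i]] is itself a complex number; positivity kills its imaginary part. *)
move=> ul; apply/cvgrPdist_lt => -[e e'] e0.
have [/eqP ee e0r] : e' == 0 /\ 0 < e by move: e0; rewrite ltcE /= => /andP[].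
subst e'; move/cvgrPdist_lt : ul => /(_ e e0r).
apply: filterS => k.
by rewrite -rmorphB normc_def /= expr0n addr0 sqrtr_sqr complexr0 ltcR.
Qed.

Lemma sqri (R : realType) : 'i * 'i = -1 :> R[i].
Proof. by rewrite -expr2 sqrCi. Qed.

(** Euler's formula term by term: as i^2 = -1, even powers feed the cosine series and odd powers the
    sine series. *)
Lemma expi_coeffE (R : realType) (t : R) (k : nat) :
  ('i * t%:C) ^+ k / k`!%:R
  = (cos_coeff t k)%:C + 'i * (sin_coeff t k)%:C :> R[i].
Proof.
rewrite /cos_coeff /sin_coeff /= !rmorphM /= !fmorphV /= !rmorphXn.
rewrite !rmorph_nat /=.
have -> : (-1)%:C = -1 :> R[i] by rewrite rmorphN1.
rewrite mulrA -mulrDl exprMn; congr (_ / _).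
rewrite !mulrA -mulrDl; congr (_ * _).
case: (boolP (odd k)) => ko /=.
  rewrite mul0r add0r mulr1.
  have kE : k = (k.-1./2).*2.+1.
    by case: k ko => //= k ko; rewrite even_halfK.
  by rewrite [in LHS]kE exprS -mul2n exprM sqrCi.
by rewrite mulr0 mul0r addr0 mul1r -{1}(even_halfK ko) -mul2n exprM sqrCi.
Qed.

Definition cis (R : realType) (t : R) : R[i] := (cos t)%:C + 'i * (sin t)%:C.

Lemma cvg_series_cos_coeff (R : realType) (t : R) :
  (series (cos_coeff t) k)%:C @[k --> \oo] --> ((cos t)%:C : R[i]).
Proof.
apply: cvg_real_complex; rewrite cos.unlock; exact: is_cvg_series_cos_coeff.
Qed.

Lemma cvg_series_sin_coeff (R : realType) (t : R) :
  (series (sin_coeff t) k)%:C @[k --> \oo] --> ((sin t)%:C : R[i]).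
Proof.
apply: cvg_real_complex; rewrite sin.unlock; exact: is_cvg_series_sin_coeff.
Qed.

Lemma expC_cis (R : realType) (t : R) : expC ('i * t%:C) = cis t.
Proof.
rewrite /expC; apply: cvg_lim; first exact: norm_hausdorff.
have -> : series (fun k : nat => ('i * t%:C) ^+ k / k`!%:R) =
  (fun k => (series (cos_coeff t) k)%:C + 'i * (series (sin_coeff t) k)%:C)
    :> (nat -> R[i]).
  apply/funext => n; rewrite /series /=.
  under eq_bigr do rewrite expi_coeffE.
  by rewrite big_split -mulr_sumr -!rmorph_sum.
apply: cvgD; first exact: cvg_series_cos_coeff.
by apply: cvgM; [exact: cvg_cst|exact: cvg_series_sin_coeff].
Qed.

(** The powers of A alternate between 1 and A, so the exponential series splits into a cosine and a
    sine series. Both Pauli matrices are of this kind. *)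
Lemma expmx_involution (R : realType) (n : nat) (A : 'M[R[i]]_n.+1) (t : R) :
  A ^+ 2 = 1 ->
  expmx (('i * t%:C) *: A) = (cos t)%:C *: 1 + ('i * (sin t)%:C) *: A.
Proof.
move=> A2; rewrite /expmx; apply: cvg_lim; first exact: norm_hausdorff.
have AX k : A ^+ k = (~~ odd k)%:R *: 1 + (odd k)%:R *: A.
  rewrite -{1}(odd_double_half k) exprD -mul2n exprM A2 expr1n mulr1.
  by case: odd; rewrite /= ?scale1r ?scale0r ?add0r ?addr0.
have -> : series (fun k : nat => (k`!%:R)^-1 *: (('i * t%:C) *: A) ^+ k) =
  (fun k => (series (cos_coeff t) k)%:C *: 1 +
            ('i * (series (sin_coeff t) k)%:C) *: A).
  apply/funext => m; rewrite /series /= !rmorph_sum mulr_sumr.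
  rewrite !scaler_suml -big_split.
  apply: eq_bigr => k _ /=.
  rewrite exprZn scalerA [_^-1 * _]mulrC expi_coeffE AX scalerDr !scalerA.
  rewrite /cos_coeff /sin_coeff /=.
  by case: (odd k); rewrite /= ?(mul0r, mulr0, rmorph0, add0r, addr0, mulr1).
apply: cvgD; apply: cvgZ; try exact: cvg_cst.
  exact: cvg_series_cos_coeff.
by apply: cvgM; [exact: cvg_cst|exact: cvg_series_sin_coeff].
Qed.

(** * Unimodular numbers and the phases psi and phi *)

Lemma cisD (R : realType) (s t : R) : cis (s + t) = cis s * cis t.
Proof.
rewrite /cis cosD sinD rmorphB rmorphD !rmorphM /=.
by ring: (sqri R).
Qed.

Lemma cis0 (R : realType) : cis (0 : R) = 1.
Proof. by rewrite /cis cos0 sin0 rmorph0 mulr0 addr0. Qed.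

Lemma cisE (R : realType) (t : R) : cis t = cos t +i* sin t.
Proof. by rewrite /cis -complexiE [RHS]complexE. Qed.

Lemma conj_cis (R : realType) (t : R) : (cis t)^* = cis (- t).
Proof. by rewrite !cisE cosN sinN. Qed.

(** This is what the choice of psi achieves. A real c is turned by pi/2; for c = x + iy with y
    nonzero the angle t has tan t = x/y, so x cos t - y sin t = 0. *)
Lemma Re_cis_nlft_psi (R : realType) (c : R[i]) :
  complex.Re (cis (- (2 * nlft_psi c)) * c) = 0.
Proof.
rewrite /nlft_psi cisE; case: eqP => [->|/eqP c0]; first by rewrite mulr0.
case: c c0 => x y c0; rewrite complex_real; case: eqP => [->|/eqP y0] /=.
  have -> : - (2 * - (pi / 4)) = pi / 2 :> R by lra.
  by rewrite cos_pihalf mul0r mulr0 subr0.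
have -> : - (2 * (- (1 / 2) * atan (x / y))) = atan (x / y) by lra.
have ct : cos (atan (x / y)) != 0.
  by rewrite gt_eqF // cos_gt0_pihalf // atan_gtNpi2 atan_ltpi2.
have : sin (atan (x / y)) = x / y * cos (atan (x / y)).
  by rewrite -{2}[x / y]atanK /tan divfK.
by move=> ->; field.
Qed.

(** The cast [complex.Re] in [nlft_phi] loses nothing. The relation is stated for i r because that
    is the off-diagonal entry of e^{i phi X} up to normalization. *)
Lemma nlft_phiP (R : realType) (c : R[i]) :
  exists2 r : R, nlft_phi (nlft_psi c) c = atan r &
  'i * r%:C = cis (- (2 * nlft_psi c)) * c.
Proof.
set d := cis _ * c; exists (complex.Re (- 'i * d)).
  rewrite /nlft_phi -mulrA; congr (atan (complex.Re (_ * (_ * _)))).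
  rewrite -expC_cis; congr expC; rewrite rmorphN rmorphM rmorph_nat /=; ring.
have := Re_cis_nlft_psi c; rewrite -/d -complexiE.
case: d => u v /= ->.
by simpc.
Qed.

(** * Reduction of the product over all integers to a finite one *)

Lemma nlft_finite (R : realType) (n : nat) (F : int -> R[i]) (z : R[i]) :
  (forall k : int, ~~ (0 <= k <= n%:Z) -> F k = 0) ->
  nlft F z = \prod_(0 <= i < n.+1) nlft_factor F z i.
Proof.
move=> Fs; have F1 k : ~~ (0 <= k <= n%:Z) -> nlft_factor F z k = 1.
  move=> /Fs Fk; rewrite /nlft_factor Fk normr0 expr0n addr0 sqrtC1 divr1.
  rewrite scale1r mul0r rmorph0 oppr0 mul0r.
  by apply/matrixP => -[[|[|//]] ?] [[|[|//]] ?]; rewrite !mxE.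
apply: cvg_lim; first exact: norm_hausdorff.
apply: cvg_near_cst.
(* A window -p <= k < q with q > n contains {0, ..., n} for every natural p, so its product already
   equals the limit. *)
exists (setT, [set q | (n < q)%N]).
  by split; [exact: filterT|exact: nbhs_infty_gt].
move=> [p q] [_ /= nq].
rewrite (big_cat_nat (n := p)) ?leq_addr //=.
rewrite big1_seq ?mul1r; last first.
  move=> i /andP[_]; rewrite mem_index_iota => /andP[_ ip].
  by apply: F1; rewrite subr_ge0 lez_nat leqNgt ip.
rewrite -{1}[p]add0n big_addn addKn.
rewrite (big_cat_nat (n := n.+1)) //=.
rewrite [X in _ * X]big1_seq ?mulr1; last first.
  move=> i /andP[_]; rewrite mem_index_iota => /andP[ni _].
  by apply: F1; rewrite PoszD addrK !lez_nat /= -ltnNge.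
by apply: eq_bigr => i _; rewrite PoszD addrK.
Qed.

(** * Closed forms of the Pauli rotations *)

Lemma sqrtC_real (R : realType) (x : R) :
  0 <= x -> sqrtC x%:C = (Num.sqrt x)%:C.
Proof.
by move=> x0; rewrite -{1}(sqr_sqrtr x0) rmorphXn /= sqrCK // ler0c sqrtr_ge0.
Qed.

Lemma sin_atan (R : realType) (r : R) :
  sin (atan r) = r * (Num.sqrt (1 + r ^+ 2))^-1.
Proof.
rewrite -cos_atan -{2}[r]atanK /tan divfK // gt_eqF // cos_gt0_pihalf //.
by rewrite atan_gtNpi2 atan_ltpi2.
Qed.

Lemma mx22_1 (R : realType) : mx22 1 0 0 1 = 1 :> 'M[R[i]]_2.
Proof. by apply/matrixP => -[[|[|//]] ?] [[|[|//]] ?]; rewrite !mxE. Qed.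

Lemma mx22D (R : realType) (a b c d a' b' c' d' : R[i]) :
  mx22 a b c d + mx22 a' b' c' d' = mx22 (a + a') (b + b') (c + c') (d + d').
Proof. by apply/matrixP => -[[|[|//]] ?] [[|[|//]] ?]; rewrite !mxE. Qed.

Lemma mx22Z (R : realType) (s a b c d : R[i]) :
  s *: mx22 a b c d = mx22 (s * a) (s * b) (s * c) (s * d).
Proof. by apply/matrixP => -[[|[|//]] ?] [[|[|//]] ?]; rewrite !mxE. Qed.

Lemma mx22M (R : realType) (a b c d a' b' c' d' : R[i]) :
  mx22 a b c d * mx22 a' b' c' d' =
  mx22 (a * a' + b * c') (a * b' + b * d') (c * a' + d * c') (c * b' + d * d').
Proof.
by apply/matrixP => -[[|[|//]] ?] [[|[|//]] ?];
  rewrite !mxE !big_ord_recl big_ord0 !mxE addr0.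
Qed.

Lemma expmx_pauliZ (R : realType) (t : R) :
  expmx (('i * t%:C) *: pauliZ R) = mx22 (cis t) 0 0 (cis (- t)).
Proof.
rewrite expmx_involution; last first.
  by rewrite expr2 mx22M -mx22_1; congr mx22; ring.
rewrite -mx22_1 !mx22Z mx22D /cis cosN sinN rmorphN /=; congr mx22; ring.
Qed.

Lemma expmx_pauliX_atan (R : realType) (r : R) :
  expmx (('i * (atan r)%:C) *: pauliX R) =
  (Num.sqrt (1 + r ^+ 2))^-1%:C *: mx22 1 ('i * r%:C) ('i * r%:C) 1.
Proof.
rewrite expmx_involution; last first.
  by rewrite expr2 mx22M -mx22_1; congr mx22; ring.
rewrite cos_atan sin_atan rmorphM.
rewrite -mx22_1 !mx22Z mx22D; congr mx22; ring.
Qed.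

(** * Telescoping of the protocol *)

(** One step of the telescoping: the diagonal matrix accumulated on the left passes through block k,
    leaves an NLFT factor behind, and comes out with phase u, to be taken as psi_{k+1}. *)
Lemma gqsp_step (R : realType) (F : int -> R[i]) (z : R[i]) (k : nat) (u : R) :
  `|z| = 1 ->
  let psi := nlft_psi (F k) in
  mx22 (z ^+ k) 0 0 1 * mx22 (cis psi) 0 0 (cis (- psi)) *
    (expmx (('i * (nlft_phi psi (F k))%:C) *: pauliX R) *
     expmx (('i * (u - psi)%:C) *: pauliZ R)) =
  nlft_factor F z k * (mx22 (z ^+ k) 0 0 1 * mx22 (cis u) 0 0 (cis (- u))).
Proof.
move=> z1 psi; rewrite expmx_pauliZ; have [r -> rE] := nlft_phiP (F k).
rewrite -/psi in rE; rewrite expmx_pauliX_atan /nlft_factor.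
have cV t : cis t * cis (- t) = 1 :> R[i] by rewrite -cisD subrr cis0.
(* Conjugate of [rE], as r is real. *)
have rE' : 'i * r%:C = - (cis (2 * psi) * (F k)^*).
  rewrite -[2 * psi]opprK -conj_cis -rmorphM -rE rmorphM /= -complexiE.
  by simpc.
(* Multiplying the two expressions for i r cancels the phases; hence cos phi is the NLFT
   normalization. *)
have r2 : r%:C ^+ 2 = `|F k| ^+ 2.
  rewrite sqr_normc; have : - ('i * r%:C) * ('i * r%:C) = F k * (F k)^*.
    by rewrite {1}rE' rE opprK mulrACA cV mul1r mulrC.
  by move=> <-; ring: (sqri R).
have -> : 1 / sqrtC (1 + `|F k| ^+ 2) = (Num.sqrt (1 + r ^+ 2))^-1%:C.
  have -> : 1 + `|F k| ^+ 2 = (1 + r ^+ 2)%:C by rewrite -r2 rmorphD rmorphXn.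
  by rewrite sqrtC_real ?addr_ge0 ?sqr_ge0 // div1r fmorphV.
have zk : z ^+ k != 0 by rewrite expf_neq0 // -normr_gt0 z1 ltr01.
have sq t : cis (2 * t) = cis t * cis t :> R[i].
  by rewrite mulr_natl mulr2n cisD.
have pV := cV psi.
have uE : cis u = cis psi * cis (u - psi) :> R[i] by rewrite -cisD subrKC.
have uNE : cis (- u) = cis (- psi) * cis (- (u - psi)) :> R[i].
  by rewrite -cisD -opprD subrKC.
rewrite -mulrN sq in rE; rewrite sq in rE'.
move: (Num.sqrt (1 + r ^+ 2))^-1%:C => s.
rewrite -exprnP -exprnN !mx22M !mx22Z !mx22M uE uNE.
congr mx22; rewrite ?rE.
- ring.
- by ring: pV.
(* The lower-left entry contains the conjugate of F_k, so the conjugate relation is used here;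
   z^{-k} cancels against z^k. *)
- by rewrite -rE rE'; field: pV.
- by field.
Qed.

Lemma gqsp_prod (R : realType) (n : nat) (F : int -> R[i]) (z : R[i]) :
  `|z| = 1 ->
  let psi := fun k : int => nlft_psi (F k) in
  gqsp n (psi 0) (fun k : nat => psi (k%:Z + 1) - psi k%:Z)
    (fun k : nat => nlft_phi (psi k%:Z) (F k%:Z)) z =
  \prod_(0 <= i < n.+1) nlft_factor F z i *
    (mx22 (z ^+ n) 0 0 1 *
     mx22 (cis (psi (n%:Z + 1))) 0 0 (cis (- psi (n%:Z + 1)))).
Proof.
move=> z1 psi; rewrite /gqsp; elim: n => [|n IHn].
  rewrite big_nil mulr1 big_nat1 -(gqsp_step _ _ _ z1) expr0 mx22_1 mul1r.
  by rewrite -expmx_pauliZ.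
rewrite big_nat_recr //= mulrA IHn -!mulrA.
rewrite [X in _ = X * _]big_nat_recr //= -!mulrA.
rewrite -(gqsp_step _ _ _ z1) [n%:Z + 1]addrC -intS !mulrA.
congr (_ * _ * _); rewrite -!mulrA; congr (_ * _).
(* The next signal operator commutes with the diagonal rotation and raises z^n to z^{n+1}. *)
by rewrite !mx22M exprSr; congr mx22; ring.
Qed.

Theorem theorem9 (R : realType) (n : nat) (F : int -> R[i])
    (a b : R[i] -> R[i])
    (F_supp : forall k : int, ~~ (0 <= k <= n%:Z) -> F k = 0)
    (F_nlft : is_nlft F a b) :
  let psi := fun k : int => nlft_psi (F k) in
  let lambda := psi 0 in
  let theta := fun k : nat => psi (k%:Z + 1) - psi k%:Z in
  let phi := fun k : nat => nlft_phi (psi k%:Z) (F k%:Z) in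
  gqsp_achieves n lambda theta phi (fun z => z ^+ n * a z) b.
Proof.
move=> psi lambda theta phi z z1.
rewrite gqsp_prod // -(nlft_finite _ F_supp) F_nlft //.
(* Index n+1 lies outside the support, where psi takes its default value 0, so the residual rotation
   is the identity. *)
have -> : nlft_psi (F (n%:Z + 1)) = 0.
  by rewrite F_supp ?/nlft_psi ?eqxx // -ltNge ltrDl.
(* The remaining diag(z^n, 1) on the right scales only the first column: a becomes z^n a and b is
   unchanged. *)
rewrite oppr0 cis0 mx22_1 mulr1 /su2_pair mx22M !mxE /=.
by rewrite !mulr0 !mulr1 addr0 add0r mulrC.
Qed.
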